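(* Every GaTEx graph is a comparability graph.
   Context: All graphs are finite, simple and undirected. A galled-tree on a finite nonempty set $X$ is a directed acyclic graph $N=(V,E)$ such that either $V=X=\{x\}$ and $E=\emptyset$, or: (N1) there is a unique root with indegree 0 and outdegree at least 2; (N2) $x\in X$ iff $x$ has outdegree 0 and indegree 1; (N3) every non-root $v\in V\setminus X$ has either indegree 1 and outdegree at least 2, or indegree 2 and outdegree at least 1 (hybrid-vertex); (N4) each biconnected component $C$ of $N$ contains at most one hybrid-vertex whose two in-neighbours both belong to $C$. For $x,y\in X$, $\mathrm{lca}_N(x,y)$ is the (unique) minimal common ancestor of $x,y$. A labeled galled-tree $(N,t)$ has $t:V\to\{0,1,\odot\}$ with $t(x)=\odot$ iff $x\in X$; it explains the graph on $X$ where $\{x,y\}$ is an edge iff $t(\mathrm{lca}_N(x,y))=1$. A graph is GaTEx if it is isomorphic to a graph explained by some labeled galled-tree. A comparability graph is a graph admitting a transitive orientation: an orientation of every edge such that arcs $(x,y)$ and $(y,z)$ imply the arc $(x,z)$. *)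

(* Defs.v *)
From HB Require Import structures.
From mathcomp Require Import all_boot.

Set Implicit Arguments.
Unset Strict Implicit.
Unset Printing Implicit Defensive.

Record sgraph := SGraph {
  svertex :> finType;
  sedge : rel svertex;
  sedge_sym : symmetric sedge;
  sedge_irr : irreflexive sedge
}.

Definition sgraph_iso (G H : sgraph) : Prop :=
  exists f : G -> H,
    bijective f /\ forall x y : G, sedge (f x) (f y) = sedge x y.

Section Digraph.

Variables (V : finType) (E : rel V).

Definition indeg (v : V) : nat := #|[set u | E u v]|.
Definition outdeg (v : V) : nat := #|[set u | E v u]|.

Definition acyclic : Prop := forall u v : V, E u v -> ~~ connect E v u.

Definition hybrid (v : V) : bool := (indeg v == 2) && (1 <= outdeg v).

(* The subgraph of the underlying undirected graph induced by C. *)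
Definition und_in (C : {set V}) : rel V :=
  [rel u v | [&& u \in C, v \in C & E u v || E v u]].

Definition und_connected (C : {set V}) : bool :=
  [forall u in C, forall v in C, connect (und_in C) u v].

(* The empty graph counts as connected in the deletion clause, so a single
   vertex and a single edge are biconnected. *)
Definition biconnected (C : {set V}) : bool :=
  [&& C != set0, und_connected C & [forall v in C, und_connected (C :\ v)]].

(* Maximal biconnected subgraphs are induced, hence given by vertex sets. *)
Definition biconnected_component (C : {set V}) : bool :=
  maxset biconnected C.

Definition common_ancestor (x y v : V) : bool :=
  connect E v x && connect E v y.

Definition min_common_ancestors (x y : V) : {set V} :=
  [set v | common_ancestor x y v &
     [forall u, (common_ancestor x y u && connect E v u) ==> (u == v)]].

(* The minimal common ancestor when it is unique, which is always the case for
   leaves x and y of a galled-tree. *)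
Definition lca (x y : V) : option V := unset1 (min_common_ancestors x y).

Variable X : {set V}.

Definition trivial_network : Prop :=
  exists x : V,
    [/\ [set: V] = [set x], X = [set x] & forall u v : V, ~~ E u v].

Definition nontrivial_galled_tree : Prop :=
  exists r : V,
    [/\ [/\ indeg r = 0, 2 <= outdeg r & forall v, indeg v = 0 -> v = r],
        forall x, (x \in X) = (outdeg x == 0) && (indeg x == 1),
        forall v, v != r -> v \notin X ->
          (indeg v == 1) && (2 <= outdeg v) || hybrid v
      & forall C, biconnected_component C ->
          #|[set h in C | hybrid h & [set u | E u h] \subset C]| <= 1].

Definition galled_tree : Prop :=
  [/\ X != set0, acyclic & trivial_network \/ nontrivial_galled_tree].

End Digraph.

(* Lodot is the symbol marking the leaves. *)
Inductive label := L0 | L1 | Lodot.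

Definition is_L1 (l : label) : bool := if l is L1 then true else false.

Definition labeling (V : finType) (X : {set V}) (t : V -> label) : Prop :=
  forall v, t v = Lodot <-> v \in X.

Section Explained.

Variables (V : finType) (E : rel V) (X : {set V}) (t : V -> label).

Definition explained_edge : rel {x : V | x \in X} :=
  [rel x y | (x != y) &&
     (if lca E (val x) (val y) is Some v then is_L1 (t v) else false)].

Lemma lcaC (x y : V) : lca E x y = lca E y x.
Proof.
have caC u : common_ancestor E x y u = common_ancestor E y x u.
  by rewrite /common_ancestor andbC.
congr unset1; apply/setP=> v; rewrite !inE caC; congr andb.
by apply: eq_forallb => u; rewrite caC.
Qed.

Lemma explained_edge_sym : symmetric explained_edge.
Proof. by move=> x y; rewrite /explained_edge /= eq_sym lcaC. Qed.

Lemma explained_edge_irr : irreflexive explained_edge.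
Proof. by move=> x; rewrite /explained_edge /= eqxx. Qed.

Definition explained_graph : sgraph :=
  SGraph explained_edge_sym explained_edge_irr.

End Explained.

Definition GaTEx (G : sgraph) : Prop :=
  exists (V : finType) (E : rel V) (X : {set V}) (t : V -> label),
    [/\ galled_tree E X, labeling X t & sgraph_iso G (explained_graph E X t)].

Definition orientation (G : sgraph) (o : rel G) : Prop :=
  (forall x y, sedge x y = o x y || o y x) /\
  (forall x y, ~~ (o x y && o y x)).

Definition comparability_graph (G : sgraph) : Prop :=
  exists o : rel G, orientation o /\ transitive o.

(* Main.v *)
From mathcomp Require Import all_boot.
Require Import Defs.

Set Implicit Arguments.
Unset Strict Implicit.
Unset Printing Implicit Defensive.

(** For a hybrid-vertex h let its gall be the set of vertices between the
    immediate dominator of h and h.  This set is biconnected because no vertex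
    strictly inside it separates its two ends, so (N4) says that the galls of
    distinct hybrid-vertices share at most one vertex.  Hence two incomparable
    ancestors of a vertex always lie on the two sides of a common gall.

    A set S of leaves is oriented by induction on its size.  Let v be a minimal
    common ancestor of S.  Unless S is spread over a single gall with top v, it
    splits into two parts all of whose cross pairs have lca v, and
    transitive orientations of the parts are put one after the other.  In the
    remaining case the leaves below the hybrid-vertex h form a module and may
    be shrunk to one leaf z.  The leaves hanging off either side of the gall
    can be oriented together with z in such a way that z is a source; cross
    pairs of the two sides P and Q have lca v.  If t v = 0, the two
    orientations are united; if t v = 1, the one on P is reversed and all edges
    between P and Q are directed from P to Q. *)

(** * Transitive orientations *)

Section TransitiveOrientation.

Variables (T : finType) (g : rel T).
Hypothesis g_sym : symmetric g.
Hypothesis g_irr : irreflexive g.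

Definition transitive_orientation (S : {set T}) (o : rel T) : Prop :=
  [/\ {in S &, forall x y, g x y = o x y || o y x},
      {in S &, forall x y, o x y -> o y x = false}
    & {in S & &, forall x y z, o x y -> o y z -> o x z}].

Definition orientable (S : {set T}) : Prop :=
  exists o, transitive_orientation S o.

Definition orientable_from (z : T) (S : {set T}) : Prop :=
  exists2 o, transitive_orientation S o & {in S, forall x, o x z = false}.

Definition homogeneous (A B : {set T}) : Prop :=
  exists b, {in A & B, forall x y, g x y = b}.

Lemma orientable_le1 (S : {set T}) : #|S| <= 1 -> orientable S.
Proof.
move=> /card_le1_eqP S1; exists [rel _ _ | false]; split=> //= x y Sx Sy.
by rewrite (S1 x y) // g_irr.
Qed.

Lemma orientable_from1 (z : T) : orientable_from z [set z].
Proof.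
exists [rel _ _ | false] => //; split=> //= x y.
by rewrite !inE => /eqP-> /eqP->; rewrite g_irr.
Qed.

(** All of [A] is placed before [B]: cross arcs, present exactly when [b] holds, only lead from [A]
    to [B], so no path leaves [A] and returns to it. *)
Lemma transitive_orientation_sum (A B : {set T}) oA oB b :
    [disjoint A & B] -> {in A & B, forall x y, g x y = b} ->
    transitive_orientation A oA -> transitive_orientation B oB ->
  transitive_orientation (A :|: B)
    [rel x y | if x \in A then if y \in A then oA x y else b
               else (y \notin A) && oB x y].
Proof.
move=> dAB gAB [eA aA tA] [eB aB tB].
have inB x : x \in A :|: B -> x \notin A -> x \in B.
  by rewrite inE => /orP[->|].
split=> /=.
- move=> x y Sx Sy; case: ifP => Ax; case: ifP => Ay /=.
  + exact: eA.
  + by rewrite (gAB x y) ?inB ?Ay // orbF.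
  + by rewrite g_sym (gAB y x) ?inB ?Ax.
  + by rewrite eB ?inB ?Ax ?Ay.
- move=> x y Sx Sy; case: ifP => Ax; case: ifP => Ay //=.
  + exact: aA.
  + by apply: aB; rewrite ?inB ?Ax ?Ay.
- move=> x y z Sx Sy Sz.
  have [Ax|Ax] := boolP (x \in A); have [Ay|Ay] := boolP (y \in A);
    have [Az|Az] := boolP (z \in A) => //=; first exact: tA.
  by apply: tB; rewrite inB.
Qed.

Lemma orientable_sum (A B : {set T}) :
    [disjoint A & B] -> homogeneous A B -> orientable A -> orientable B ->
  orientable (A :|: B).
Proof.
move=> dAB [b gAB] [oA A_o] [oB B_o]; eexists.
exact: (transitive_orientation_sum dAB gAB A_o B_o).
Qed.

(** With [B] placed after [A], no new arc enters [z]. *)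
Lemma orientable_from_sum (z : T) (A B : {set T}) :
    z \in A -> [disjoint A & B] -> homogeneous A B ->
    orientable_from z A -> orientable B ->
  orientable_from z (A :|: B).
Proof.
move=> Az dAB [b gAB] [oA A_o zA] [oB B_o]; eexists.
  exact: (transitive_orientation_sum dAB gAB A_o B_o).
by move=> x Sx /=; rewrite Az /=; case: ifP => // /zA.
Qed.

(** Substitution: pairs inside [M] use the orientation of [M], and all other pairs use that of the
    set in which [M] is contracted to [m]. *)
Lemma orientable_module (S M : {set T}) (m : T) :
    M \subset S -> m \in M ->
    {in S :\: M & M, forall x y, g x y = g x m} ->
    orientable M -> orientable (m |: (S :\: M)) ->
  orientable S.
Proof.
move=> /subsetP MS Mm gM [o1 [e1 a1 t1]] [o2 [e2 a2 t2]].
pose f x := if x \in M then m else x.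
have fS x : x \in S -> f x \in m |: (S :\: M).
  by move=> Sx; rewrite /f; case: ifP => Mx; rewrite !inE ?eqxx ?Mx ?Sx ?orbT.
have o2m : o2 m m = false.
  by apply/negP=> omm; move: (a2 m m); rewrite !inE eqxx omm => /(_ isT isT isT).
exists [rel x y | if (x \in M) && (y \in M) then o1 x y else o2 (f x) (f y)].
split=> /=.
- move=> x y Sx Sy; rewrite [(y \in M) && _]andbC.
  case: (boolP (x \in M)) => Mx; case: (boolP (y \in M)) => My /=; last 3 first.
  + rewrite -e2 ?fS // /f Mx (negPf My) g_sym [RHS]g_sym.
    by apply: gM => //; rewrite inE My.
  + rewrite -e2 ?fS // /f My (negPf Mx).
    by apply: gM => //; rewrite inE Mx.
  + by rewrite -e2 ?fS // /f (negPf My) (negPf Mx).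
  + exact: e1.
- move=> x y Sx Sy; rewrite [(y \in M) && _]andbC.
  by case: ifP => [/andP[]|_]; [apply: a1 | apply: a2; apply: fS].
- move=> x y z Sx Sy Sz; have := t2 _ _ _ (fS _ Sx) (fS _ Sy) (fS _ Sz).
  rewrite /f; have [Mx|Mx] := boolP (x \in M); have [My|My] := boolP (y \in M);
    have [Mz|Mz] := boolP (z \in M) => //=.
  - by move=> _; apply: t1.
  (* A path that leaves [M] and returns to it would give a loop at [m]. *)
  - by move=> /[apply]/[apply]; rewrite o2m.
Qed.

(* If P and Q are joined, z is made a sink of P and a source of Q, with all
   edges oriented from P to Q; otherwise z is made a source of both sides. *)
Lemma orientable_glue (P Q : {set T}) (z : T) :
    z \notin P -> z \notin Q -> [disjoint P & Q] -> homogeneous P Q ->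
    orientable_from z (z |: P) -> orientable_from z (z |: Q) ->
  orientable (z |: (P :|: Q)).
Proof.
move=> Pz Qz dPQ [b gPQ] [oP [eP aP tP] zP] [oQ [eQ aQ tQ] zQ].
have PQ x : x \in P -> x \in Q = false by apply: disjointFr.
have split3 x : x \in z |: (P :|: Q) ->
    [\/ [/\ x = z, x \in P = false & x \in Q = false],
        [/\ x \in P, x \in Q = false & x == z = false]
      | [/\ x \in Q, x \in P = false & x == z = false]].
  rewrite !inE => /orP[/eqP->|/orP[] xS].
  - by constructor 1; rewrite (negPf Pz) (negPf Qz).
  - constructor 2; rewrite PQ //; split=> //.
    by apply/eqP=> xz; rewrite -xz xS in Pz.
  - constructor 3; split=> //; first by apply/negP=> /PQ; rewrite xS.
    by apply/eqP=> xz; rewrite -xz xS in Qz.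
have Pin x : x \in P -> x \in z |: P by rewrite inE orbC => ->.
have Qin x : x \in Q -> x \in z |: Q by rewrite inE orbC => ->.
have zinP : z \in z |: P by rewrite !inE eqxx.
have zinQ : z \in z |: Q by rewrite !inE eqxx.
(* In [o1] a path from [P] through [z] to [Q] is closed by the arcs joining all of [P] to all of
   [Q]; in [o0] no arc enters [z], so no path passes through it. *)
pose o1 x y := if x == z then (y \in Q) && oQ x y
  else if x \in P then
    if y \in Q then true else if y == z then oP z x else oP y x
  else (y \in Q) && oQ x y.
pose o0 x y := if x == z then if y \in P then oP x y else (y \in Q) && oQ x y
  else if x \in P then (y \in P) && oP x y else (y \in Q) && oQ x y.
exists (if b then o1 else o0).
have zPz x : x \in P -> oP x z = false by move=> Px; apply/zP/Pin.
have zQz x : x \in Q -> oQ x z = false by move=> Qx; apply/zQ/Qin.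
have eP' x : x \in P -> g x z = oP z x /\ g z x = oP z x.
  by move=> Px; rewrite [g x z]g_sym (eP z x zinP (Pin _ Px)) zPz // orbF.
have eQ' x : x \in Q -> g x z = oQ z x /\ g z x = oQ z x.
  by move=> Px; rewrite [g x z]g_sym (eQ z x zinQ (Qin _ Px)) zQz // orbF.
have gQP x y : x \in Q -> y \in P -> g x y = b.
  by move=> Qx Py; rewrite g_sym gPQ.
case: b gPQ gQP => gPQ gQP; rewrite /o0 /o1; split.
- move=> x y /split3[] [x1 x2 x3] /split3[] [y1 y2 y3];
    rewrite ?x1 ?x2 ?x3 ?y1 ?y2 ?y3 ?eqxx ?(negPf Pz) ?(negPf Qz) ?g_irr //=.
  + by case: (eP' y).
  + by rewrite orbF; case: (eQ' y).
  + by rewrite orbF; case: (eP' x).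
  + by rewrite orbC eP ?Pin.
  + exact: gPQ.
  + by case: (eQ' x).
  + exact: gQP.
  + by rewrite eQ ?Qin.
- move=> x y /split3[] [x1 x2 x3] /split3[] [y1 y2 y3];
    rewrite ?x1 ?x2 ?x3 ?y1 ?y2 ?y3 ?eqxx ?(negPf Pz) ?(negPf Qz) ?g_irr //=.
  + by apply: aP; apply: Pin.
  + by apply: aQ; apply: Qin.
- move=> x y w /split3[] [x1 x2 x3] /split3[] [y1 y2 y3] /split3[] [w1 w2 w3];
    rewrite ?x1 ?x2 ?x3 ?y1 ?y2 ?y3 ?w1 ?w2 ?w3 ?eqxx
      ?(negPf Pz) ?(negPf Qz) ?g_irr //=.
  + by apply: tQ => //; apply: Qin.
  + by move=> yx zy; apply: (tP z y x) => //; apply: Pin.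
  + by move=> yx wy; apply: (tP w y x) => //; apply: Pin.
  + by apply: tQ => //; apply: Qin.
- move=> x y /split3[] [x1 x2 x3] /split3[] [y1 y2 y3];
    rewrite ?x1 ?x2 ?x3 ?y1 ?y2 ?y3 ?eqxx ?(negPf Pz) ?(negPf Qz) ?g_irr //=.
  + by rewrite orbF; case: (eP' y).
  + by rewrite orbF; case: (eQ' y).
  + by case: (eP' x).
  + by rewrite eP ?Pin.
  + exact: gPQ.
  + by case: (eQ' x).
  + exact: gQP.
  + by rewrite eQ ?Qin.
- move=> x y /split3[] [x1 x2 x3] /split3[] [y1 y2 y3];
    rewrite ?x1 ?x2 ?x3 ?y1 ?y2 ?y3 ?eqxx ?(negPf Pz) ?(negPf Qz) ?g_irr //=.
  + by apply: aP; apply: Pin.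
  + by apply: aQ; apply: Qin.
- move=> x y w /split3[] [x1 x2 x3] /split3[] [y1 y2 y3] /split3[] [w1 w2 w3];
    rewrite ?x1 ?x2 ?x3 ?y1 ?y2 ?y3 ?w1 ?w2 ?w3 ?eqxx
      ?(negPf Pz) ?(negPf Qz) ?g_irr //=.
  + by apply: tP => //; apply: Pin.
  + by apply: tQ => //; apply: Qin.
  + by apply: tP => //; apply: Pin.
  + by apply: tQ => //; apply: Qin.
Qed.

End TransitiveOrientation.

(** * Reachability and biconnectivity *)

Section Reachability.

Variables (V : finType) (E : rel V).

(** Only the arcs leaving [a] are deleted, so a path may end at [a] but not pass through it. *)
Definition avoiding (e : rel V) (a : V) : rel V := [rel u w | e u w && (u != a)].

Lemma connect_avoiding_start (e : rel V) a u w :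
  connect e u w -> connect (avoiding e a) u w || connect e u a.
Proof.
move=> /connectP[p]; elim: p u => [|x p IHp] u /=.
  by move=> _ ->; rewrite connect0.
move=> /andP[eux px] /(IHp _ px); have [->|ua] := eqVneq u a.
  by rewrite [connect e a a]connect0 orbT.
case/orP=> [cxw|cxa]; apply/orP; [left | right].
  by apply: connect_trans cxw; apply: connect1; rewrite /avoiding /= eux.
exact: connect_trans (connect1 eux) cxa.
Qed.

Lemma connect_avoiding_end (e : rel V) a u w :
  connect e u w -> connect (avoiding e a) u w || connect e a w.
Proof.
move=> /connectP[p]; elim: p u => [|x p IHp] u /=.
  by move=> _ ->; rewrite connect0.
move=> /andP[eux px] lp; case/orP: (IHp _ px lp) => [cxw|->]; last by rewrite orbT.
have [ua|ua] := eqVneq u a; apply/orP; [right | left]; last first.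
  by apply: connect_trans cxw; apply: connect1; rewrite /avoiding /= eux.
rewrite -ua; apply/connectP; exists (x :: p) => //=; by rewrite eux.
Qed.

Lemma sub_connect_avoiding (e : rel V) a : subrel (connect (avoiding e a)) (connect e).
Proof. by apply: connect_sub => u w /andP[euw _]; apply: connect1. Qed.

Lemma connect_avoiding_same (e : rel V) a w : connect (avoiding e a) a w -> w = a.
Proof. by case/connectP=> [[|x p]] //=; rewrite /avoiding /= eqxx andbF. Qed.

Lemma connect_first_step (e : rel V) u w :
  connect e u w -> u != w -> exists2 x, e u x & connect e x w.
Proof.
case/connectP=> [[|x p]] /= => [_ ->|/andP[eux px] lp _]; first by rewrite eqxx.
by exists x => //; apply/connectP; exists p.
Qed.

Lemma connect_last_step (e : rel V) u w :
  connect e u w -> u != w -> exists2 x, e x w & connect e u x.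
Proof.
case/connectP=> p; case: (lastP p) => [_ ->|q x]; first by rewrite eqxx.
rewrite rcons_path last_rcons => /andP[pq eqx] -> _.
by exists (last u q) => //; apply/connectP; exists q.
Qed.

Lemma connect_und_in (e : rel V) (D : {set V}) a b :
    subrel e E -> (forall u, connect e a u -> connect e u b -> u \in D) ->
  connect e a b -> connect (und_in E D) a b.
Proof.
move=> eE + /connectP[p]; elim: p a => [|x p IHp] a /=.
  by move=> _ _ ->; rewrite connect0.
move=> inD /andP[eax px] lp.
have cxb : connect e x b by apply/connectP; exists p.
apply: connect_trans (IHp x _ px lp); last first.
  by move=> u cxu; apply: inD; apply: connect_trans (connect1 eax) cxu.
have cab := connect_trans (connect1 eax) cxb.
apply: connect1; rewrite /und_in /= (eE _ _ eax) !inD //; exact: connect1.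
Qed.

Lemma connect_und_in_sym (D : {set V}) : connect_sym (und_in E D).
Proof.
apply: sym_connect_sym => u w; rewrite /und_in /=.
by rewrite [E u w || _]orbC andbCA.
Qed.

Lemma und_connected_center (D : {set V}) z :
  {in D, forall u, connect (und_in E D) u z} -> und_connected E D.
Proof.
move=> Dz; apply/forall_inP=> u Du; apply/forall_inP=> w Dw.
apply: connect_trans (Dz u Du) _; rewrite connect_und_in_sym; exact: Dz.
Qed.

Lemma connect_und_inS (A B : {set V}) :
  A \subset B -> subrel (connect (und_in E A)) (connect (und_in E B)).
Proof.
move=> /subsetP AB; apply: connect_sub => u w /and3P[Au Aw Euw].
by apply: connect1; rewrite /und_in /= !AB.
Qed.

Lemma und_connectedU (A B : {set V}) z :
    z \in A -> z \in B -> und_connected E A -> und_connected E B ->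
  und_connected E (A :|: B).
Proof.
move=> Az Bz cA cB; apply: (@und_connected_center _ z) => u.
rewrite inE => /orP[Au|Bu].
  apply: connect_und_inS (subsetUl A B) _ _ _.
  by move/forall_inP/(_ u Au)/forall_inP: cA; apply.
apply: connect_und_inS (subsetUr A B) _ _ _.
by move/forall_inP/(_ u Bu)/forall_inP: cB; apply.
Qed.

Lemma und_connected_biconnectedD1 (A : {set V}) v :
  biconnected E A -> und_connected E (A :\ v).
Proof.
case/and3P=> _ cA /forall_inP cAv; have [/cAv //|Av] := boolP (v \in A).
suff -> : A :\ v = A by [].
by apply/setDidPl; rewrite disjoint_sym disjoints1.
Qed.

(** Deleting one vertex leaves [y] or [z] to hold the two pieces together. *)
Lemma biconnectedU (A B : {set V}) y z :
    y != z -> y \in A -> y \in B -> z \in A -> z \in B ->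
    biconnected E A -> biconnected E B ->
  biconnected E (A :|: B).
Proof.
move=> yz Ay By Az Bz bA bB; apply/and3P; split.
- by apply/set0Pn; exists y; rewrite inE Ay.
- by case/and3P: bA bB => _ cA _ /and3P[_ cB _]; apply: (und_connectedU Ay By).
- apply/forall_inP=> v _; rewrite setDUl.
  have dA := @und_connected_biconnectedD1 A v bA.
  have dB := @und_connected_biconnectedD1 B v bB.
  have [yv|yv] := eqVneq y v.
    by apply: (@und_connectedU _ _ z) => //; rewrite !inE -yv eq_sym yz.
  by apply: (@und_connectedU _ _ y) => //; rewrite !inE yv.
Qed.

Hypothesis E_acyclic : acyclic E.

Lemma connect_anti u w : connect E u w -> connect E w u -> u = w.
Proof.
move=> uw wu; apply/eqP; apply/idPn => /(connect_first_step uw)[x Eux xw].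
by move: (E_acyclic Eux); rewrite (connect_trans xw wu).
Qed.

Definition below (v : V) : {set V} := [set u | connect E v u].

Lemma card_below_lt u w : connect E u w -> u != w -> #|below w| < #|below u|.
Proof.
move=> uw unw; apply/proper_card/properP; split.
  by apply/subsetP=> x; rewrite !inE; apply: connect_trans.
exists u; rewrite !inE ?connect0 //; apply: contra unw => wu.
by rewrite (connect_anti uw wu).
Qed.

Definition interval (a b : V) : {set V} := [set w | connect E a w && connect E w b].

(** After deletion of [v], a vertex not above [v] still reaches [b], and one not below [v] is still
    reached from [a]. For [v] strictly between, the second hypothesis joins [a] to [b]. *)
Lemma biconnected_interval a b :
    connect E a b ->
    (forall w, w \in interval a b -> w != a -> w != b ->
      connect (avoiding E w) a b) ->
  biconnected E (interval a b).
Proof.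
move=> ab cut; pose I := interval a b.
have Ia : a \in I by rewrite inE connect0 ab.
have Ib : b \in I by rewrite inE connect0 ab.
have avoid v u w : u \in I -> w \in I -> w != v -> connect (avoiding E v) u w ->
    connect (und_in E (I :\ v)) u w.
  rewrite !inE => /andP[au ub] /andP[aw wb] wv; apply: connect_und_in.
    by move=> ? ? /andP[].
  move=> x ux xw; rewrite !inE.
  rewrite (connect_trans au (sub_connect_avoiding ux)).
  rewrite (connect_trans (sub_connect_avoiding xw) wb) !andbT.
  by apply: contraNneq wv => xv; move: xw; rewrite xv => /connect_avoiding_same->.
apply/and3P; split; first by apply/set0Pn; exists a.
  apply: (@und_connected_center _ b) => u; rewrite inE => /andP[au ub].
  apply: (@connect_und_in E) => // x ux xb.
  by rewrite inE xb (connect_trans au ux).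
apply/forall_inP=> v Iv; have := Iv; rewrite inE => /andP[av vb].
have to_b u : u \in I -> ~~ connect E u v -> connect (und_in E (I :\ v)) u b.
  move=> Iu uv; have := Iu; rewrite inE => /andP[au ub].
  apply: avoid => //; first by apply: contraNneq uv => <-.
  by have := connect_avoiding_start v ub; rewrite (negPf uv) orbF.
have from_a u : u \in I -> ~~ connect E v u -> connect (und_in E (I :\ v)) a u.
  move=> Iu vu; have := Iu; rewrite inE => /andP[au ub].
  apply: avoid => //; first by apply: contraNneq vu => <-.
  by have := connect_avoiding_end v au; rewrite (negPf vu) orbF.
have anti u : u != v -> connect E v u -> ~~ connect E u v.
  by move=> uv vu; apply: contra uv => uv; rewrite (connect_anti uv vu).
have [va|va] := eqVneq v a.
  apply: (@und_connected_center _ b) => u /setD1P[uv Iu].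
  by apply: to_b => //; apply: anti => //; rewrite va; move: Iu; rewrite inE => /andP[].
apply: (@und_connected_center _ a) => u /setD1P[uv Iu].
rewrite connect_und_in_sym; have [vu|] := boolP (connect E v u); last exact: from_a.
have [vb'|vnb] := eqVneq v b.
  by move: (anti u uv vu) Iu; rewrite vb' inE => /negPf->; rewrite andbF.
apply: (@connect_trans _ _ b); first by apply: avoid; rewrite 1?eq_sym //; apply: cut.
by rewrite connect_und_in_sym; apply: to_b => //; apply: anti.
Qed.

End Reachability.

(** * Galls *)

Section Galls.

Variables (V : finType) (E : rel V) (X : {set V}) (r : V).
Hypothesis E_acyclic : acyclic E.
Hypothesis r_indeg : indeg E r = 0.
Hypothesis r_unique : forall v, indeg E v = 0 -> v = r.
Hypothesis leafE : forall x, (x \in X) = (outdeg E x == 0) && (indeg E x == 1).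
Hypothesis innerP : forall v, v != r -> v \notin X ->
  (indeg E v == 1) && (2 <= outdeg E v) || hybrid E v.
Hypothesis one_hybrid : forall C, biconnected_component E C ->
  #|[set h in C | hybrid E h & [set u | E u h] \subset C]| <= 1.

Local Notation "u ~> w" := (connect E u w) (at level 70).
Let anti := connect_anti E_acyclic.

Lemma edge_not_back u w : E u w -> w ~> u -> False.
Proof. by move=> /E_acyclic/negP. Qed.

Lemma edge_neq u w : E u w -> u != w.
Proof. by move=> Euw; apply/eqP=> uw; apply: (edge_not_back Euw); rewrite uw connect0. Qed.

Lemma root_connect v : r ~> v.
Proof.
have [n] := ubnP #|[set u | u ~> v]|; elim: n v => // n IHn v /ltnSE le_n.
have [->|vr] := eqVneq v r; first exact: connect0.
have /set0Pn[u] : [set u | E u v] != set0.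
  by apply: contraNneq vr => v0; rewrite (r_unique (v := v)) // /indeg v0 cards0.
rewrite inE => Euv; apply: connect_trans (connect1 Euv); apply: IHn.
apply: leq_trans le_n; apply/proper_card/properP; split.
  by apply/subsetP=> x; rewrite !inE => /connect_trans-> //; apply: connect1.
by exists v; rewrite !inE ?connect0 // (E_acyclic Euv).
Qed.

Lemma parent_unique v a b : ~~ hybrid E v -> E a v -> E b v -> a = b.
Proof.
move=> hv Eav Ebv; suff /card_le1_eqP le1 : indeg E v <= 1 by apply: le1; rewrite inE.
have [->|vr] := eqVneq v r; first by rewrite r_indeg.
have [|vX] := boolP (v \in X); first by rewrite leafE => /andP[_ /eqP->].
by have := innerP vr vX; rewrite (negPf hv) orbF => /andP[/eqP->].
Qed.

Lemma hybrid_parents h a b c : hybrid E h -> E a h -> E b h -> E c h ->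
  [\/ a = b, a = c | b = c].
Proof.
case/andP=> /eqP h2 _ Ea Eb Ec.
have [->|ab] := eqVneq a b; first by constructor.
have [->|ac] := eqVneq a c; first by constructor.
have [->|bc] := eqVneq b c; first by constructor.
suff: 2 < indeg E h by rewrite h2.
by apply/card_gt2P; exists a, b, c; rewrite !inE [c == a]eq_sym.
Qed.

Lemma hybrid_neq_root h : hybrid E h -> h != r.
Proof. by case/andP=> /eqP h2 _; apply/eqP=> hr; rewrite hr r_indeg in h2. Qed.

(** Carries (N4) over from biconnected components to all biconnected sets, by extending [C] to a
    maximal one. *)
Lemma hybrid_biconnected_inj (C : {set V}) h k :
    biconnected E C -> hybrid E h -> hybrid E k ->
    h \in C -> k \in C ->
    (forall u, E u h -> u \in C) -> (forall u, E u k -> u \in C) ->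
  h = k.
Proof.
move=> bC hh hk Ch Ck Eh Ek; have [D mD /subsetP CD] := maxset_exists bC.
move/card_le1_eqP: (one_hybrid mD); apply; rewrite !inE CD //.
  by rewrite hk; apply/subsetP=> u; rewrite inE => /Ek/CD.
by rewrite hh; apply/subsetP=> u; rewrite inE => /Eh/CD.
Qed.

(* Every path from the root to h passes through a: a vertex from which h is
   reached without leaving a must lie below a. *)
Definition dominates (a h : V) : bool :=
  [forall v, connect (avoiding E a) v h ==> (a ~> v)].

(* The immediate dominator of h. *)
Definition gall_top (h : V) : V :=
  [arg min_(a < r | (a != h) && dominates a h) #|below E a|].

Lemma gall_topP h : hybrid E h ->
  [/\ gall_top h != h, dominates (gall_top h) h
    & forall a, a != h -> dominates a h -> #|below E (gall_top h)| <= #|below E a|].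
Proof.
move=> hh; rewrite /gall_top; case: arg_minnP.
  rewrite eq_sym hybrid_neq_root //=; apply/forallP=> v.
  by rewrite root_connect implybT.
by move=> a /andP[ah da] min_a; split=> // b bh db; apply: min_a; rewrite bh.
Qed.

Lemma dominatesP a h v : dominates a h -> connect (avoiding E a) v h -> a ~> v.
Proof. by move=> /forallP/(_ v)/implyP. Qed.

Lemma gall_top_connect h : hybrid E h -> gall_top h ~> h.
Proof. by case/gall_topP=> _ /dominatesP dom _; apply: dom. Qed.

Lemma gall_top_comparable h v : hybrid E h -> v ~> h ->
  (gall_top h ~> v) || (v ~> gall_top h).
Proof.
case/gall_topP=> _ /dominatesP dom _ /(connect_avoiding_start (gall_top h)).
by case/orP=> [/dom->|->] //; rewrite orbT.
Qed.

Lemma gall_top_parent h p : hybrid E h -> E p h -> gall_top h ~> p.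
Proof.
case/gall_topP=> _ /dominatesP dom _ Eph; have [->|pt] := eqVneq p (gall_top h).
  exact: connect0.
by apply: dom; apply: connect1; rewrite /avoiding /= Eph.
Qed.

Definition gall (h : V) : {set V} := interval E (gall_top h) h.

Lemma gall_hybrid h : hybrid E h -> h \in gall h.
Proof. by move=> hh; rewrite inE connect0 gall_top_connect. Qed.

Lemma gall_parent h p : hybrid E h -> E p h -> p \in gall h.
Proof. by move=> hh Eph; rewrite inE gall_top_parent // connect1. Qed.

(** An interior vertex [w] does not dominate [h], having fewer vertices below it than the top. Hence
    some [v] not below [w] reaches [h] while avoiding [w]. *)
Lemma gall_biconnected h : hybrid E h -> biconnected E (gall h).
Proof.
move=> hh; have [_ /dominatesP dom min_top] := gall_topP hh.
apply: biconnected_interval => //; first exact: gall_top_connect.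
move=> w; rewrite inE => /andP[tw wh] wt wnh.
have: ~~ dominates w h.
  apply/negP=> /(min_top _ wnh); rewrite leqNgt card_below_lt //.
  by rewrite eq_sym.
case/forallPn=> v; rewrite negb_imply => /andP[vh wv].
have [tv|tv] := boolP (gall_top h ~> v).
  apply: connect_trans vh; have := connect_avoiding_end w tv.
  by rewrite (negPf wv) orbF.
(* Since [v] is not below the top, its path to [h] must pass through the top, and the final segment
   of that path avoids [w]. *)
have := connect_avoiding_end (gall_top h) vh; case/orP=> // vh'.
case/negP: tv; apply: dom; apply: connect_sub vh' => x y.
by case/andP=> /andP[Exy _] xt; apply: connect1; rewrite /avoiding /= Exy.
Qed.

(** The union of two galls with two common vertices is biconnected and contains both hybrid-vertices
    with all their in-neighbours. *)
Lemma gall_inj h k y z : hybrid E h -> hybrid E k -> y != z ->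
  y \in gall h -> z \in gall h -> y \in gall k -> z \in gall k -> h = k.
Proof.
move=> hh hk yz yh zh yk zk.
apply: (@hybrid_biconnected_inj (gall h :|: gall k)) => //.
- exact: biconnectedU yz yh yk zh zk (gall_biconnected hh) (gall_biconnected hk).
- by rewrite inE gall_hybrid.
- by rewrite inE [X in _ || X]gall_hybrid // orbT.
- by move=> u Eu; rewrite inE gall_parent.
- by move=> u Eu; rewrite inE [X in _ || X]gall_parent // orbT.
Qed.

(** * Vertices of a gall other than its top *)

Definition on_gall (h w : V) : bool :=
  [&& hybrid E h, w \in gall h & w != gall_top h].

Lemma on_gall_last_step h w : on_gall h w ->
  exists2 u, E u w & u \in gall h.
Proof.
case/and3P=> hh; rewrite inE => /andP[tw wh]; rewrite eq_sym => tnw.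
have [u Euw tu] := connect_last_step tw tnw; exists u => //.
by rewrite inE tu (connect_trans (connect1 Euw)).
Qed.

(** Both [w] and its in-neighbour on the gall of [h] also lie on the gall of [w]. *)
Lemma on_gall_hybrid h w : on_gall h w -> hybrid E w -> w = h.
Proof.
move=> hw ww; have [u Euw hu] := on_gall_last_step hw; case/and3P: hw => hh hw _.
exact: gall_inj ww hh (edge_neq Euw) (gall_parent ww Euw) (gall_hybrid ww) hu hw.
Qed.

(** If [w] is not hybrid, its only in-neighbour lies with it on both galls. The top has to be
    excluded, as it may be shared by several galls. *)
Lemma on_gall_inj h k w : on_gall h w -> on_gall k w -> h = k.
Proof.
move=> hw kw; have [ww|ww] := boolP (hybrid E w).
  by rewrite -(on_gall_hybrid hw ww) (on_gall_hybrid kw ww).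
have [u Euw hu] := on_gall_last_step hw; have [u' Eu'w ku] := on_gall_last_step kw.
rewrite -(parent_unique ww Euw Eu'w) in ku.
by case/and3P: hw kw => hh hw _ /and3P[hk kw _]; apply: gall_inj (edge_neq Euw) hu hw ku kw.
Qed.

Lemma on_gall_self h : hybrid E h -> on_gall h h.
Proof.
by move=> hh; rewrite /on_gall hh gall_hybrid // eq_sym; case/gall_topP: hh.
Qed.

Lemma on_gall_connect h w : on_gall h w -> w ~> h.
Proof. by case/and3P=> _; rewrite inE => /andP[]. Qed.

Lemma on_gall_below h w w' : on_gall h w -> w ~> w' -> w' ~> h -> on_gall h w'.
Proof.
case/and3P=> hh; rewrite inE => /andP[tw wh] wt ww' w'h.
rewrite /on_gall hh inE (connect_trans tw ww') w'h /=.
apply: contraNneq wt => w't; rewrite w't in ww'.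
by rewrite (anti ww' tw).
Qed.

(** Induction on the number of ancestors of [u]. If [u] is not hybrid, both vertices lie above its
    only in-neighbour. If [u] is hybrid and one of them lies above the top of its gall, so does the
    other; failing that, both lie on this gall. *)
Lemma on_gall_incomparable u v w : v ~> u -> w ~> u ->
    ~~ (v ~> w) -> ~~ (w ~> v) ->
  exists h, [/\ on_gall h v, on_gall h w & h ~> u].
Proof.
have [n] := ubnP #|[set x | x ~> u]|; elim: n u => // n IHn u /ltnSE le_n.
move=> vu wu vw wv.
have vnu : v != u by apply: contraNneq wv => ->.
have wnu : w != u by apply: contraNneq vw => ->.
have rec x : x ~> u -> x != u -> v ~> x -> w ~> x ->
    exists h, [/\ on_gall h v, on_gall h w & h ~> u].
  move=> xu xnu vx wx; have [|h [hv hw hx]] := IHn x _ vx wx vw wv.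
    apply: leq_trans le_n; apply/proper_card/properP; split.
      by apply/subsetP=> y; rewrite !inE => /connect_trans->.
    exists u; rewrite !inE ?connect0 //; apply: contra xnu => ux.
    by rewrite (anti xu ux).
  by exists h; split=> //; apply: connect_trans hx xu.
have [hu|hu] := boolP (hybrid E u); last first.
  have [x Exu vx] := connect_last_step vu vnu.
  have [y Eyu wy] := connect_last_step wu wnu.
  rewrite -(parent_unique hu Exu Eyu) in wy.
  exact: rec (connect1 Exu) (edge_neq Exu) vx wy.
have [tnu _ _] := gall_topP hu; have tu := gall_top_connect hu.
have [vt|vt] := boolP (v ~> gall_top u).
  have := gall_top_comparable hu wu; case/orP=> [tw|wt].
    by rewrite (connect_trans vt tw) in vw.
  exact: rec tu tnu vt wt.
have := gall_top_comparable hu vu; rewrite (negPf vt) orbF => tv.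
have [wt|wt] := boolP (w ~> gall_top u).
  by rewrite (connect_trans wt tv) in wv.
have := gall_top_comparable hu wu; rewrite (negPf wt) orbF => tw.
exists u; rewrite /on_gall hu !inE tv tw vu wu /=; split=> //.
  by apply: contraNneq vt => ->; apply: connect0.
by apply: contraNneq wt => ->; apply: connect0.
Qed.

(** * Children of one vertex on a common gall *)

Lemma on_gall_triangle v c d : E v c -> E v d -> c != d -> c ~> d ->
  on_gall d c /\ on_gall d d.
Proof.
move=> Evc Evd cd c_d; have [u Eud cu] := connect_last_step c_d cd.
(* The in-neighbour [u] of [d] lies below [c], so it differs from [v]. *)
have hd : hybrid E d.
  apply/idPn => hd; apply: (edge_not_back Evc).
  by rewrite (parent_unique hd Evd Eud).
split; last exact: on_gall_self.
have tv := gall_top_parent hd Evd.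
rewrite /on_gall hd inE (connect_trans tv (connect1 Evc)) c_d /=.
by apply/eqP=> ct; apply: (edge_not_back Evc); rewrite ct.
Qed.

Lemma on_gall_siblings u v c d : E v c -> E v d -> c != d -> c ~> u -> d ~> u ->
  exists h, [/\ on_gall h c, on_gall h d & h ~> u].
Proof.
move=> Evc Evd cd cu du.
have [c_d|c_d] := boolP (c ~> d).
  by exists d; have [] := on_gall_triangle Evc Evd cd c_d.
have [d_c|d_c] := boolP (d ~> c); last exact: on_gall_incomparable.
by exists c; rewrite eq_sym in cd; have [] := on_gall_triangle Evd Evc cd d_c.
Qed.

(** Assigns to each child [c] of [v] on the gall an in-neighbour of [h], namely [v] itself if [c] is
    [h]. As [h] has two in-neighbours, injectivity of this assignment bounds the number of such
    children. *)
Lemma on_gall_parent h v c : E v c -> on_gall h c ->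
  exists2 p, E p h & (c ~> p) || (c == h) && (p == v).
Proof.
move=> Evc hc; have [ch|ch] := eqVneq c h.
  by exists v; rewrite -?ch ?eqxx ?orbT.
have [p Eph cp] := connect_last_step (on_gall_connect hc) ch.
by exists p => //; rewrite cp.
Qed.

(** Distinct children above the same [p] share a gall whose hybrid-vertex lies above [p]. By
    [on_gall_inj] this is [h], and the arc from [p] to [h] closes a directed cycle. *)
Lemma on_gall_parent_inj h p v c d : E v c -> E v d -> E p h ->
    on_gall h c -> on_gall h d ->
    (c ~> p) || (c == h) && (p == v) -> (d ~> p) || (d == h) && (p == v) ->
  c = d.
Proof.
move=> Evc Evd Eph hc hd.
case/orP=> [cp|/andP[/eqP-> /eqP pv]]; case/orP=> [dp|/andP[/eqP-> /eqP pv']] //.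
- apply/eqP/idPn=> cd; have [k [kc kd kp]] := on_gall_siblings Evc Evd cd cp dp.
  rewrite -(on_gall_inj hc kc) in kp.
  by case: (edge_not_back Eph).
- by rewrite pv' in cp; case: (edge_not_back Evc).
- by rewrite pv in dp; case: (edge_not_back Evd).
Qed.

Lemma on_gall_siblings3 h v c d e : E v c -> E v d -> E v e ->
  on_gall h c -> on_gall h d -> on_gall h e -> [\/ c = d, c = e | d = e].
Proof.
move=> Evc Evd Eve hc hd he; have hh : hybrid E h by case/and3P: hc.
have [p Ep cp] := on_gall_parent Evc hc.
have [q Eq dq] := on_gall_parent Evd hd.
have [s Es es] := on_gall_parent Eve he.
case: (hybrid_parents hh Ep Eq Es) => eqp; [constructor 1|constructor 2|constructor 3].
- by apply: (on_gall_parent_inj Evc Evd Ep); rewrite // eqp.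
- by apply: (on_gall_parent_inj Evc Eve Ep); rewrite // eqp.
- by apply: (on_gall_parent_inj Evd Eve Eq); rewrite // eqp.
Qed.

(** * Least common ancestors *)

Lemma hybrid_comparable h v y : hybrid E h -> h ~> y -> v ~> y ->
  (v ~> h) || (h ~> v).
Proof.
move=> hh hy vy; apply/idPn; rewrite negb_or => /andP[vh hv].
(* Being hybrid and on the gall of [k], [h] equals [k], so [v] lies above [h] after all. *)
have [k [kv kh _]] := on_gall_incomparable vy hy vh hv.
by case/negP: vh; rewrite (on_gall_hybrid kh hh); apply: on_gall_connect.
Qed.

(** A common ancestor [w] not above [v] would yield a child of [v] above both [x] and [y]: directly
    if [w] is below [v]; otherwise [v] and [w] lie on one gall, the same for [x] and [y], whose
    hybrid-vertex is above both. *)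
Lemma lca_split v x y : v ~> x -> v ~> y ->
    (forall c, E v c -> c ~> x -> c ~> y -> False) ->
  lca E x y = Some v.
Proof.
move=> vx vy nochild.
have above w : w ~> x -> w ~> y -> w ~> v.
  move=> wx wy; apply/idPn=> wv.
  have vnw : v != w by apply: contraNneq wv => ->.
  have [vw|vw] := boolP (v ~> w).
    have [c Evc cw] := connect_first_step vw vnw.
    by apply: (nochild c Evc); [apply: connect_trans cw wx | apply: connect_trans cw wy].
  have [h [hw hv hx]] := on_gall_incomparable wx vx wv vw.
  have [k [kw _ ky]] := on_gall_incomparable wy vy wv vw.
  rewrite -(on_gall_inj hw kw) in ky.
  have vh : v != h by apply: contraNneq wv => ->; apply: on_gall_connect.
  have [c Evc ch] := connect_first_step (on_gall_connect hv) vh.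
  by apply: (nochild c Evc); [apply: connect_trans ch hx | apply: connect_trans ch ky].
rewrite /lca -(set1K v); congr unset1; apply/setP=> w; rewrite !inE /common_ancestor.
apply/andP/eqP=> [[/andP[wx wy] /forallP/(_ v)]|->].
  by rewrite vx vy above //= => /eqP->.
rewrite vx vy; split=> //; apply/forallP=> u; apply/implyP=> /andP[/andP[ux uy] vu].
by rewrite (anti (above u ux uy) vu).
Qed.

(** A common ancestor of [x] and a vertex below [h] is comparable with [h] and, because of [x], not
    below it; so it is above everything below [h]. *)
Lemma lca_below_hybrid h x y z : hybrid E h -> ~~ (h ~> x) -> h ~> y -> h ~> z ->
  lca E x y = lca E x z.
Proof.
move=> hh hx hy hz.
have sub y' z' v : h ~> y' -> h ~> z' -> common_ancestor E x y' v -> common_ancestor E x z' v.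
  move=> hy' hz' /andP[vx vy]; rewrite /common_ancestor vx /=.
  case/orP: (hybrid_comparable hh hy' vy) => [vh|hv]; first exact: connect_trans vh hz'.
  by case/negP: hx; apply: connect_trans hv vx.
have eqca v : common_ancestor E x y v = common_ancestor E x z v.
  by apply/idP/idP; apply: sub.
congr unset1; apply/setP=> v; rewrite !inE eqca; congr (_ && _).
by apply: eq_forallb => u; rewrite eqca.
Qed.

(** * Orienting sets of leaves *)

Variable t : V -> label.

(** The relation [explained_edge] taken on all of [V], so that sets of leaves need no subtype. *)
Definition leaf_edge : rel V :=
  [rel x y | (x != y) && (if lca E x y is Some v then is_L1 (t v) else false)].

Lemma leaf_edge_sym : symmetric leaf_edge.
Proof. by move=> x y; rewrite /leaf_edge /= eq_sym lcaC. Qed.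

Lemma leaf_edge_irr : irreflexive leaf_edge.
Proof. by move=> x; rewrite /leaf_edge /= eqxx. Qed.

Lemma homogeneous_split v (A B : {set V}) :
    [disjoint A & B] -> A \subset below E v -> B \subset below E v ->
    {in A & B, forall x y c, E v c -> c ~> x -> c ~> y -> False} ->
  homogeneous leaf_edge A B.
Proof.
move=> dAB /subsetP vA /subsetP vB nochild; exists (is_L1 (t v)) => x y Ax By.
have xy : x != y by apply: contraTneq Ax => ->; rewrite (disjointFl dAB By).
rewrite /leaf_edge /= xy (@lca_split v) //; last exact: nochild.
  by move/vA: Ax; rewrite inE.
by move/vB: By; rewrite inE.
Qed.

Lemma minimal_cover (S : {set V}) c : S \subset below E c ->
  exists v, [/\ c ~> v, S \subset below E v
    & forall e, E v e -> ~~ (S \subset below E e)].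
Proof.
move=> Sc; pose P v := (c ~> v) && (S \subset below E v).
have Pc : P c by rewrite /P connect0.
case: (arg_minnP (fun v => #|below E v|) Pc) => v /andP[cv Sv] min_v.
exists v; split=> // e Eve; apply/negP=> Se.
have: P e by rewrite /P Se (connect_trans cv (connect1 Eve)).
move/min_v; rewrite leqNgt card_below_lt ?connect1 //; exact: edge_neq.
Qed.

(* Along one side of the gall of h, with u the only chosen vertex below h, the
   sets hanging off the side are peeled from the top; u stays a source because
   each peeled set is put last. *)
Lemma orientable_from_side h c q u (S : {set V}) :
    on_gall h c -> E q h -> ~~ (c ~> q) -> h ~> u ->
    u \in S -> S \subset below E c ->
    {in S, forall x, x != u -> ~~ (h ~> x)} ->
    (forall A : {set V}, A \subset S -> u \notin A -> orientable leaf_edge A) ->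
  orientable_from leaf_edge u S.
Proof.
move=> hc Eqh cq hu.
have hh : hybrid E h by case/and3P: hc.
have [n] := ubnP #|S|; elim: n S => // n IHn S /ltnSE le_n Su Sc Sh IH.
have [Seq|[x]] : S = [set u] \/ exists x, x \in S /\ x != u.
  have [|/set0Pn[x]] := eqVneq (S :\ u) set0.
    by move/eqP; rewrite setD_eq0 subset1 => /orP[/eqP|/eqP S0];
      [left | rewrite S0 inE in Su].
  by rewrite !inE => /andP[xu Sx]; right; exists x.
- by rewrite Seq; apply: orientable_from1 leaf_edge_irr _.
case=> Sx xu; have [v [cv Sv min_v]] := minimal_cover Sc.
have vu : v ~> u by move/subsetP/(_ u Su): Sv; rewrite inE.
have vx : v ~> x by move/subsetP/(_ x Sx): Sv; rewrite inE.
have hv : ~~ (h ~> v) by apply: contra (Sh x Sx xu) => hv; apply: connect_trans hv vx.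
have vh : v ~> h by have := hybrid_comparable hh hu vu; rewrite (negPf hv) orbF.
have vnh : v != h by apply: contraNneq hv => ->; apply: connect0.
(* The child [e] of [v] towards [h] lies on the gall again: the leaves below [e] form a smaller
   instance, and the others are peeled off. *)
have [e Eve eh] := connect_first_step vh vnh.
have ce : c ~> e := connect_trans cv (connect1 Eve).
have he : on_gall h e by apply: on_gall_below hc ce eh.
rewrite -(setID S (below E e)).
have Bu : u \in S :&: below E e by rewrite !inE Su (connect_trans eh).
have dAB : [disjoint S :&: below E e & S :\: below E e].
  rewrite disjoints_subset; apply/subsetP=> y /setIP[_ ey].
  by rewrite in_setC in_setD ey.
apply: orientable_from_sum => //.
- exact: leaf_edge_sym.
- apply: (@homogeneous_split v) => //.
  + by apply: subset_trans Sv; apply: subsetIl.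
  + by apply: subset_trans Sv; apply: subsetDl.
  (* A child [d] of [v] above both leaves would lie on the gall too. Neither [d] nor [e] reaches [h]
     through [q], which is not below [c], so they share an in-neighbour of [h] and coincide. *)
  + move=> y z; rewrite !inE => /andP[Sy ey] /andP[ez Sz] d Evd dy dz.
    have ed : e != d by apply: contraNneq ez => ->.
    have [k [ke kd ky]] := on_gall_siblings Eve Evd ed ey dy.
    rewrite -(on_gall_inj he ke) in kd.
    have off_q w p : E v w -> E p h -> (w ~> p) || (w == h) && (p == v) -> p != q.
      move=> Evw Eph wp; apply: contraNneq cq => <-; case/orP: wp => [wp|].
        exact: connect_trans (connect_trans cv (connect1 Evw)) wp.
      by case/andP=> _ /eqP->.
    have [p Eph ep] := on_gall_parent Eve he.
    have [p' Ep'h dp'] := on_gall_parent Evd kd.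
    case: (hybrid_parents hh Eph Ep'h Eqh) => eqp.
    * rewrite -eqp in dp'; case/eqP: ed.
      exact: on_gall_parent_inj Eve Evd Eph he kd ep dp'.
    * by case/eqP: (off_q e p Eve Eph ep).
    * by case/eqP: (off_q d p' Evd Ep'h dp').
- apply: IHn => //.
  + apply: leq_trans le_n; apply: proper_card; rewrite properEneq subsetIl andbT.
    by apply/eqP=> /setIidPl Se; case/negP: (min_v e Eve).
  + by apply: subset_trans Sc; apply: subsetIl.
  + by move=> y /setIP[/Sh].
  + by move=> A AS; apply: IH; apply: subset_trans AS _; apply: subsetIl.
- by apply: IH; rewrite ?subsetDl // !inE (connect_trans eh).
Qed.

Lemma orientable_leaves (S : {set V}) : S \subset X -> orientable leaf_edge S.
Proof.
have [n] := ubnP #|S|; elim: n S => // n IHn S /ltnSE le_n SX.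
have IH (A : {set V}) : A \proper S -> orientable leaf_edge A.
  move=> AS; apply: IHn; first exact: leq_trans (proper_card AS) le_n.
  exact: subset_trans (proper_sub AS) SX.
have [S1|/card_gt1P[x0 [y0 [Sx0 Sy0 xy0]]]] := leqP #|S| 1.
  by apply: orientable_le1 => //; apply: leaf_edge_irr.
have [v [_ Sv min_v]] : exists v, [/\ r ~> v, S \subset below E v
    & forall e, E v e -> ~~ (S \subset below E e)].
  by apply: minimal_cover; apply/subsetP=> x _; rewrite inE root_connect.
have leaf x w : x \in S -> x ~> w -> w = x.
  move/(subsetP SX); rewrite leafE => /andP[/eqP/cards0_eq out0 _] xw.
  apply/eqP; rewrite eq_sym; apply/idPn=> /(connect_first_step xw)[c Exc _].
  by move/setP/(_ c): out0; rewrite !inE Exc.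
have child x : x \in S -> exists2 c, E v c & c ~> x.
  move=> Sx; have := subsetP Sv x Sx; rewrite inE => vx.
  apply: (connect_first_step vx); apply: contraNneq xy0 => vx'.
  have vS y : y \in S -> y = x.
    by move=> Sy; apply: leaf Sx _; rewrite -vx'; have := subsetP Sv y Sy; rewrite inE.
  by rewrite (vS x0) // (vS y0).
(* Splits off leaves whose lca with every remaining leaf is [v]; both parts are proper subsets of
   [S]. *)
have peel (A : {set V}) : A \proper S -> A != set0 ->
    {in A & S :\: A, forall x y c, E v c -> c ~> x -> c ~> y -> False} ->
    orientable leaf_edge S.
  move=> AS A0 cross; have sAS := proper_sub AS.
  have dA : [disjoint A & S :\: A]
    by rewrite disjoints_subset; apply/subsetP=> x Ax; rewrite !inE Ax.
  rewrite -(setID S A) (setIidPr sAS); apply: orientable_sum => //.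
  - exact: leaf_edge_sym.
  - apply: (@homogeneous_split v) => //; first exact: subset_trans sAS Sv.
    exact: subset_trans (subsetDl _ _) Sv.
  - exact: IH.
  - apply: IH; rewrite properEneq subsetDl andbT; apply: contraNneq A0 => /setDidPl.
    by rewrite -setI_eq0 (setIidPr sAS).
have below_proper c : E v c -> S :&: below E c \proper S.
  move=> Evc; rewrite properEneq subsetIl andbT.
  by apply/eqP=> /setIidPl; apply/negP; apply: min_v.
have [c Evc cx0] := child x0 Sx0.
(* Unless another child [d] shares a leaf of [S] with [c], the leaves below [c] can be peeled
   off. *)
have [/existsP[d /existsP[u /and5P[Evd cd Su cu du]]]|alone] := boolP
  [exists d, exists u, [&& E v d, c != d, u \in S, c ~> u & d ~> u]]; last first.
  apply: (peel (S :&: below E c)); first exact: below_proper.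
    by apply/set0Pn; exists x0; rewrite !inE Sx0.
  move=> x y; rewrite !inE => /andP[Sx cx] /andP[] + Sy; rewrite Sy /=.
  move=> cy e Eve ex ey.
  case/negP: alone; apply/existsP; exists e; apply/existsP; exists x.
  by rewrite Eve Sx cx ex !andbT /=; apply: contraNneq cy => ->.
have [h [hc hd hu]] := on_gall_siblings Evc Evd cd cu du.
have hh : hybrid E h by case/and3P: hc.
(* Any further child above such a leaf would be a third child of [v] on the gall of [h]. *)
have third x e : E v e -> (c ~> x) || (d ~> x) -> e ~> x -> (e == c) || (e == d).
  move=> Eve + ex; apply: contraTT; rewrite negb_or => /andP[ec ed].
  suff he : on_gall h e -> False.
    apply/negP=> /orP[cx|dx]; apply: he.
      have [k [ke kc _]] := on_gall_siblings Eve Evc ec ex cx.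
      by rewrite (on_gall_inj hc kc).
    have [k [ke kd _]] := on_gall_siblings Eve Evd ed ex dx.
    by rewrite (on_gall_inj hd kd).
  move=> he; case: (on_gall_siblings3 Evc Evd Eve hc hd he) => eq.
  - by rewrite eq eqxx in cd.
  - by rewrite eq eqxx in ec.
  - by rewrite eq eqxx in ed.
have [Scd|Scd] := boolP (S \subset below E c :|: below E d); last first.
  apply: (peel (S :&: (below E c :|: below E d))).
  - rewrite properEneq subsetIl andbT; by apply: contra Scd => /eqP/setIidPl.
  - by apply/set0Pn; exists x0; rewrite !inE Sx0 cx0.
  - move=> x y; rewrite !inE => /andP[Sx cdx] /andP[] + Sy; rewrite Sy /=.
    move=> cdy e Eve ex ey.
    by case/orP: (third x e Eve cdx ex) => /eqP ee; rewrite -ee ey ?orbT in cdy.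
have below_h x : c ~> x -> d ~> x -> h ~> x.
  move=> cx dx; have [k [kc _ kx]] := on_gall_siblings Evc Evd cd cx dx.
  by rewrite (on_gall_inj hc kc).
have h_c x : h ~> x -> c ~> x by apply: connect_trans; apply: on_gall_connect.
have h_d x : h ~> x -> d ~> x by apply: connect_trans; apply: on_gall_connect.
have Sor x : x \in S -> (c ~> x) || (d ~> x).
  by move/(subsetP Scd); rewrite !inE.
have /subsetPn[xP SxP] := min_v d Evd; rewrite inE => dxP.
have cxP : c ~> xP by have := Sor xP SxP; rewrite (negPf dxP) orbF.
have /subsetPn[xQ SxQ] := min_v c Evc; rewrite inE => cxQ.
have dxQ : d ~> xQ by have := Sor xQ SxQ; rewrite (negPf cxQ).
pose H := S :&: below E h.
(* If [H] has several leaves, it is a module by [lca_below_hybrid]. Both [H], which misses [xP], and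
   the contracted set, which loses a leaf of [H], are smaller than [S]. *)
have [H1|H1] := leqP #|H| 1; last first.
  have HS : H \subset S by apply: subsetIl.
  have Hu : u \in H by rewrite !inE Su.
  have xPH : xP \notin H by rewrite !inE SxP; apply: contra dxP; apply: h_d.
  apply: (@orientable_module _ _ leaf_edge_sym S H u) => //.
  - move=> x y; rewrite !inE => /andP[] + Sx; rewrite Sx /= => hx /andP[Sy hy].
    rewrite /leaf_edge /= (lca_below_hybrid hh hx hy hu); congr (_ && _).
    by rewrite !(contraNneq _ hx) // => ->.
  - by apply: IH; apply/properP; split=> //; exists xP.
  - have [w [w' [Hw Hw' ww']]] := card_gt1P H1.
    have [z Hz zu] : exists2 z, z \in H & z != u.
      have [wu|] := eqVneq w u; last by exists w.
      by exists w' => //; rewrite -wu eq_sym.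
    apply: IH; apply/properP; split.
      by rewrite subUset sub1set Su subsetDl.
    exists z; first exact: (subsetP HS).
    by rewrite inE in_setD Hz in_set1 (negPf zu).
have only_u x : x \in S -> h ~> x -> x = u.
  by move=> Sx hx; apply: (card_le1_eqP H1); rewrite !inE ?Su ?Sx.
have cnh : c != h by apply: contraNneq dxP => ch; apply: h_d; rewrite -ch.
have dnh : d != h by apply: contraNneq cxQ => dh; apply: h_c; rewrite -dh.
(* The two children reach [h] through different in-neighbours, [c] through [p] and [d] through [q],
   and neither reaches that of the other. *)
have [p Eph cp] := connect_last_step (on_gall_connect hc) cnh.
have [q Eqh dq] := connect_last_step (on_gall_connect hd) dnh.
have cq : ~~ (c ~> q).
  apply/negP=> cq; case/eqP: cd.
  by apply: (on_gall_parent_inj Evc Evd Eqh hc hd); rewrite ?cq ?dq.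
have dp : ~~ (d ~> p).
  apply/negP=> dp; case/eqP: cd.
  by apply: (on_gall_parent_inj Evc Evd Eph hc hd); rewrite ?cp ?dp.
(* The leaves not below [d] hang off the side of [c], and vice versa; a leaf below both is below
   [h], hence is [u]. *)
have -> : S = u |: ((S :\: below E d) :|: (S :\: below E c)).
  apply/setP=> x; rewrite !inE; have [->|xu] := eqVneq x u => //=.
  rewrite -andb_orl -negb_and; case Sx: (x \in S); rewrite ?andbF //= andbT.
  by apply/esym; apply: contra xu => /andP[dx cx]; rewrite (only_u x) ?below_h.
(* Treats both sides at once: [e] heads the side, [k] is the other child, and [s] is the
   in-neighbour of [h] not below [e]. Subsets without [u] are proper in [S], so the induction
   hypothesis covers them. *)
have side e k s : on_gall h e -> E s h -> ~~ (e ~> s) ->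
    (forall x, x \in S -> ~~ (k ~> x) -> e ~> x) ->
    (forall x, h ~> x -> e ~> x) -> (forall x, h ~> x -> k ~> x) ->
    orientable_from leaf_edge u (u |: (S :\: below E k)).
  move=> he Esh es ke h_e h_k.
  apply: (@orientable_from_side h e s u) => //.
  - by rewrite !inE eqxx.
  - apply/subsetP=> y; rewrite !inE => /orP[/eqP->|/andP[ky Sy]]; first exact: h_e.
    exact: ke.
  - move=> y; rewrite !inE => /orP[/eqP->|/andP[ky Sy]]; first by rewrite eqxx.
    by move=> _; apply: contra ky; apply: h_k.
  - move=> A /subsetP Asub uA; apply: IH; apply/properP; split.
      by apply/subsetP=> y /Asub; rewrite !inE => /orP[/eqP->|/andP[]].
    by exists u.
have dPQ : [disjoint S :\: below E d & S :\: below E c].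
  rewrite -setI_eq0; apply/eqP/setP=> x; rewrite !inE.
  case Sx: (x \in S); rewrite ?andbF //= !andbT -negb_or orbC.
  by rewrite Sor.
apply: orientable_glue.
- exact: leaf_edge_sym.
- exact: leaf_edge_irr.
- by rewrite !inE du.
- by rewrite !inE cu.
- exact: dPQ.
- apply: (@homogeneous_split v) => //.
  + exact: subset_trans (subsetDl _ _) Sv.
  + exact: subset_trans (subsetDl _ _) Sv.
  + move=> x y; rewrite !inE => /andP[dx Sx] /andP[cy Sy] e Eve ex ey.
    case/orP: (third x e Eve (Sor x Sx) ex) => /eqP ee.
      by rewrite -ee ey in cy.
    by rewrite -ee ex in dx.
- apply: (side c d q) => //.
  by move=> x Sx dx; have := Sor x Sx; rewrite (negPf dx) orbF.
- apply: (side d c p) => //.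
  by move=> x Sx cx; have := Sor x Sx; rewrite (negPf cx).
Qed.

End Galls.

Lemma galled_tree_orientable (V : finType) (E : rel V) (X : {set V}) t :
  galled_tree E X -> orientable (leaf_edge E t) X.
Proof.
case=> _ acyc [[x [_ -> _]]|[r [[r0 _ r_uniq] leafE innerP one]]].
  by apply: orientable_le1; [apply: leaf_edge_irr | rewrite cards1].
exact: (orientable_leaves acyc r0 r_uniq leafE innerP one).
Qed.

Theorem mainTheorem8 (G : sgraph) : GaTEx G -> comparability_graph G.
Proof.
case=> V [E [X [t [tree _ [f [_ f_edge]]]]]].
have [o [oE o_anti o_trans]] := galled_tree_orientable t tree.
have fX x : val (f x) \in X by apply: valP.
exists [rel x y | o (val (f x)) (val (f y))]; split; first split.
(* Equality in the subtype of leaves is equality of values, so [explained_edge] and [leaf_edge]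
   agree by conversion. *)
- by move=> x y; rewrite -f_edge -oE.
- by move=> x y; apply/negP=> /andP[/= oxy]; rewrite (o_anti _ _ (fX x) (fX y) oxy).
- by move=> y x z /=; exact: o_trans (fX x) (fX y) (fX z).
Qed.
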